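(* Let $\mathbb{K}\in\{\mathbb{R},\mathbb{C}\}$ and let $X$ be an infinite-dimensional normed vector space over $\mathbb{K}$. Suppose $o(X)=|X|=\dim X$. Then there exists a (Hamel) basis of $X$ which is a connected and locally connected subset of the unit sphere $\{x\in X:\ \|x\|=1\}$.
   Context: $|S|$ denotes the cardinality of a set $S$. $\dim X$ denotes the algebraic (Hamel) dimension of $X$, i.e. the cardinality of an algebraic basis of $X$ over $\mathbb{K}$. $o(X)$ denotes the cardinality of the family of all open subsets of $X$ (with respect to the norm topology). A basis always means an algebraic (Hamel) basis; connectedness and local connectedness refer to the subspace topology induced by the norm. *)

(* Defs.v *)
From HB Require Import structures.
From mathcomp Require Import all_boot all_order all_algebra.
From mathcomp Require Import all_classical all_reals all_analysis.
From mathcomp Require Export complex.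
Set Implicit Arguments. Unset Strict Implicit. Unset Printing Implicit Defensive.
Import Order.TTheory GRing.Theory Num.Theory.
Local Open Scope classical_set_scope.
Local Open Scope ring_scope.

Section Hamel.
Variables (K : numDomainType) (X : normedModType K).

Definition lin_indep (B : set X) : Prop :=
  forall (s : seq X) (c : nat -> K),
    uniq s -> (forall x, x \in s -> B x) ->
    \sum_(i < size s) c i *: nth 0 s i = 0 ->
    forall i, (i < size s)%N -> c i = 0.

Definition spanning (B : set X) : Prop :=
  forall x : X, exists (s : seq X) (c : nat -> K),
    (forall y, y \in s -> B y) /\ x = \sum_(i < size s) c i *: nth 0 s i.

Definition hamel_basis (B : set X) : Prop := lin_indep B /\ spanning B.

Definition infinite_dimensional : Prop :=
  ~ exists s : seq X, spanning [set x | x \in s].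

(* dim X = |A| : some Hamel basis of X has the cardinality of A
   (by dimension invariance all bases then have this cardinality). *)
Definition dim_card_eq {T} (A : set T) : Prop :=
  exists B : set X, hamel_basis B /\ (B #= A)%card.

Definition open_sets : set (set X) := [set U | open U].

Definition unit_sphere : set X := [set x | `|x| = 1].

(* A is locally connected in its subspace topology: every point x of A has
   a base of connected neighbourhoods in A, i.e. for every neighbourhood U of
   x (in X) there is a connected N included in A `&` U which is a
   neighbourhood of x relative to A (it contains A `&` V for some
   neighbourhood V of x in X). *)
Definition locally_connected_set (A : set X) : Prop :=
  forall x, A x -> forall U, nbhs x U ->
    exists N : set X, [/\ N `<=` A `&` U, connected N &
      exists V, nbhs x V /\ A `&` V `<=` N].

Definition hypotheses : Prop :=
  infinite_dimensional /\ (open_sets #= [set: X])%card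
  /\ dim_card_eq [set: X].

Definition conclusion : Prop :=
  exists B : set X, [/\ hamel_basis B, B `<=` unit_sphere,
                        connected B & locally_connected_set B].
End Hamel.

(* Main.v *)
Require Import Defs.
From HB Require Import structures.
From mathcomp Require Import all_boot all_order all_algebra.
From mathcomp Require Import all_classical all_reals all_analysis.
From mathcomp Require Import complex.
From mathcomp Require wochoice.

(** Write k for the common value of o(X), |X| and dim X.  List all closed subsets
    of X along a well-order of type k, and choose for each of them, if possible, a
    unit vector in it outside the span of the earlier choices.  The chosen vectors
    are independent by construction, and they span X since every closed set [{u}]
    with u a unit vector is in the list.  At each stage fewer than k vectors have
    been chosen; so the resulting basis B meets every closed F whose unit vectors
    do not lie in the span of fewer than k vectors.

    Let Z be [X \ {0}] or a ball missing 0, and let W be the closure of the radial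
    projection of Z to the unit sphere.  If disjoint relatively open sets U and V
    separated the intersection of B and W, then B would miss the closed set
    F = W \ (U u V).  But F is not contained in the span of any set Y of fewer than
    k vectors: take z1, z2 in Z projecting into U, V and w outside span(Y, z1, z2)
    such that the segments [z1, w] and [w, z2] lie in Z.  The projected path from
    z1 to z2 is connected, so it meets F, at a point other than the projections of
    z1 and z2; and such a point is outside span(Y). *)

Set Implicit Arguments. Unset Strict Implicit. Unset Printing Implicit Defensive.
Import Order.TTheory GRing.Theory Num.Theory.
Import numFieldNormedType.Exports.
Local Open Scope classical_set_scope.
Local Open Scope card_scope.
Local Open Scope ring_scope.

(** * Well-founded recursion and initial well-orders *)

Lemma wf_rec (T U : Type) (lt : T -> T -> Prop) (F : T -> set U -> U) :
  well_founded lt ->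
  exists f : T -> U, forall b, f b = F b (f @` [set g | lt g b]).
Proof.
move=> wf.
pose G b (rec : forall g, lt g b -> U) :=
  F b [set y | exists g (p : lt g b), y = rec g p].
exists (Fix wf (fun=> U) G) => b; rewrite Fix_eq; last first.
  move=> x f g fg; rewrite /G; congr F; apply/seteqP.
  by split=> y [z [p ->]]; exists z, p.
congr F; apply/seteqP; split=> y; first by move=> [g [p ->]]; exists g.
by move=> [g p <-]; exists g, p.
Qed.

Record strict_well_order (T : Type) (lt : T -> T -> Prop) : Prop := SWO {
  swo_wf : well_founded lt ;
  swo_trans : forall y x z, lt x y -> lt y z -> lt x z ;
  swo_total : forall x y, [\/ lt x y, x = y | lt y x] }.

Lemma strict_well_order_exists (T : eqType) :
  exists lt : T -> T -> Prop, strict_well_order lt.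
Proof.
have [R wo] := wochoice.well_ordering_principle T.
have minP (A : set T) : A !=set0 -> exists2 z, A z & forall y, A y -> R z y.
  move=> [a Aa]; have [|z [[zA zle] _]] := wo (fun x => `[<A x>]).
    by exists a; apply/asboolP.
  exists z; first exact/asboolP.
  by move=> y Ay; apply: zle; apply/asboolP.
(* Least elements are unique; on [{x, y}] this forces antisymmetry. *)
have anti x y : R x y -> R y x -> x = y.
  move=> xy yx; have [|z [_ zu]] := wo (fun t => (t == x) || (t == y)).
    by exists x; rewrite unfold_in eqxx.
  have refl t : R t t by have [|s -> ss] := minP [set t]; [exists t|exact: ss].
  rewrite -(zu x) ?(zu y)//; split; rewrite ?unfold_in ?eqxx ?orbT//.
    by move=> t; rewrite unfold_in => /orP[/eqP->|/eqP->].
  by move=> t; rewrite unfold_in => /orP[/eqP->|/eqP->].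
have tot x y : R x y \/ R y x.
  have [|z] := minP [set x; y]; first by exists x; left.
  by move=> [->|->] zl; [left|right]; apply: zl; [right|left].
have trans y x z : R x y -> R y z -> R x z.
  move=> xy yz; have [|t] := minP [set x; y; z]; first by exists x; left; left.
  move=> [[->|tE]|tE] tl; first by apply: tl; right.
    by rewrite (anti x y)// -tE; apply: tl; left; left.
  have zy : R z y by rewrite -tE; apply: tl; left; right.
  by rewrite -(anti y z).
exists (fun x y => R x y /\ x <> y); split.
- move=> a; apply: contrapT => na.
  have [|z nz zl] := minP [set x | ~ Acc (fun x y => R x y /\ x <> y) x].
    by exists a.
  apply: nz; constructor => y [yz ney]; apply: contrapT => ny.
  by apply: ney; apply: anti => //; apply: zl.
- move=> y x z [xy nxy] [yz nyz]; split; first exact: trans yz.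
  by move=> xz; apply: nxy; apply: anti => //; rewrite xz.
- move=> x y; have [->|/eqP nxy] := eqVneq x y; first by constructor 2.
  have [xy|yx] := tot x y; first by constructor 1.
  by constructor 3; split=> // /esym.
Qed.

Lemma wf_min (T : Type) (lt : T -> T -> Prop) (A : set T) :
  well_founded lt -> A !=set0 ->
  exists2 z, A z & forall y, A y -> ~ lt y z.
Proof.
move=> wf [a Aa]; apply: contrapT => h.
elim/(well_founded_ind wf): a Aa => a IH Aa; apply: h; exists a => // y Ay ya.
exact: IH ya Ay.
Qed.

Lemma swo_irr (T : Type) (lt : T -> T -> Prop) x : strict_well_order lt -> ~ lt x x.
Proof.
by move=> lto; elim/(well_founded_ind (swo_wf lto)): x => x IH xx;
  exact: (IH _ xx xx).
Qed.

Lemma swo_wf_in (T : Type) (A : set T) (lt : T -> T -> Prop) :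
  strict_well_order lt -> well_founded (fun g h => A g /\ lt g h).
Proof.
move=> lto x; elim/(well_founded_ind (swo_wf lto)): x => x IH.
by constructor => y [_ /IH].
Qed.

(* [D] represents an initial ordinal: it is equipotent to [T], but none of its
   proper initial segments is. *)
Lemma initial_well_order (T : choiceType) :
  exists (lt : T -> T -> Prop) (D : set T),
    [/\ strict_well_order lt, [set: T] #<= D &
    forall b, D b -> ~ ([set: T] #<= D `&` [set g | lt g b])].
Proof.
have [lt lto] := strict_well_order_exists T; exists lt.
(* Cut at the least point whose initial segment is as large as [T], if there is one; otherwise keep
   all of [T]. *)
have [[b Tb]|/forallNP h] := pselect
  (exists b, [set: T] #<= [set g | lt g b]); last first.
  by exists setT; split=> // b _; rewrite setTI; apply: h.
have [|a Ta amin] :=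
  @wf_min _ lt [set b | [set: T] #<= [set g | lt g b]] (swo_wf lto).
  by exists b.
exists [set g | lt g a]; split=> // c ca Tc; apply: (amin c) => //=.
apply: card_le_trans Tc _; apply: subset_card_le => g []//.
Qed.

(** * Adjoining a point to an infinite set *)

Lemma infinite_setU1_le (T : pointedType) (a : T) (Y : set T) :
  infinite_set Y -> a |` Y #<= Y.
Proof.
move=> /infiniteP/pcard_leP[g].
have gi m n : g m = g n -> m = n by apply: inj; rewrite inE.
have gY n : Y (g n) by exact: funS.
have [Ya|nYa] := pselect (Y a); first by apply: subset_card_le => x [->|].
(* Hilbert's hotel: the sequence [g] moves up by one, leaving [g 0] free for [a]. *)
pose h x := if pselect (exists n, g n = x) is left e then g (projT1 (cid e)).+1
            else if x == a then g 0%N else x.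
have hg n : h (g n) = g n.+1.
  by rewrite /h; case: pselect => [e|[]]; [case: (cid e) => m /= /gi ->|exists n].
have ha : h a = g 0%N.
  by rewrite /h eqxx; case: pselect => // -[n an]; exfalso; apply: nYa; rewrite -an.
have hP x : (a |` Y) x -> [\/ x = a, exists n, x = g n |
    h x = x /\ forall n, x <> g n].
  move=> Yx; have [->|/eqP xa] := eqVneq x a; first by constructor 1.
  have [[n xn]|nx] := pselect (exists n, g n = x); first by constructor 2; exists n.
  constructor 3; split; last by move=> n xn; apply: nx; exists n.
  by rewrite /h; case: pselect => //; move/eqP/negPf: xa => ->.
have hi : {in a |` Y &, injective h}.
  move=> x y /set_mem/hP hx /set_mem/hP hy.
  case: hx hy => [->|[m ->]|[hx nx]] [->|[n ->]|[hy ny]];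
    rewrite ?ha ?hg ?hx ?hy => // e; try by [have := gi _ _ e => -[->]];
    try by [have := gi _ _ e]; exfalso; solve [exact: ny (esym e)|exact: nx e].
rewrite -(card_le_eql (inj_card_eq hi)); apply: subset_card_le => _ [x Yx <-].
have [->|[n ->]|[hx _]] := hP x Yx; rewrite ?ha ?hg//.
case: Yx => [-> | ]; rewrite ?ha// hx//.
Qed.

Lemma infinite_le_setU1 (T : pointedType) (a : T) (A Y : set T) :
  infinite_set A -> A #<= a |` Y -> A #<= Y.
Proof.
move=> infA AY; apply: (card_le_trans AY); apply: infinite_setU1_le => finY.
apply: infA; apply: card_le_finite AY _.
by rewrite finite_setU; split=> //; exact: finite_set1.
Qed.

(** * Linear spans *)

Section Span.
Variables (K : numFieldType) (X : lmodType K).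
Implicit Types (A B : set X) (x y : X).

(** Adding one term at a time turns facts about spans into inductions; [span_list] recovers explicit
    sums. *)
Inductive lspan A : X -> Prop :=
| span0 : lspan A 0
| spanZD k a x : A a -> lspan A x -> lspan A (k *: a + x).

Lemma spanD A x y : lspan A x -> lspan A y -> lspan A (x + y).
Proof.
move=> + Ay; elim=> [|k a z Aa _ IH]; rewrite ?add0r// -addrA; exact: spanZD.
Qed.

Lemma span_sub A x : A x -> lspan A x.
Proof.
move=> Ax; rewrite -[x]addr0 -[x in x + _]scale1r.
by apply: spanZD => //; exact: span0.
Qed.

Lemma spanZ A k x : lspan A x -> lspan A (k *: x).
Proof.
elim=> [|l a z Aa _ IH]; rewrite ?scaler0; first exact: span0.
by rewrite scalerDr scalerA; apply: spanZD.
Qed.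

Lemma spanB A x y : lspan A x -> lspan A y -> lspan A (x - y).
Proof. by move=> Ax /(spanZ (-1)); rewrite scaleN1r; apply: spanD. Qed.

Lemma span_trans A B x : A `<=` lspan B -> lspan A x -> lspan B x.
Proof.
move=> AB; elim=> [|k a z Aa _ IH]; first exact: span0.
by apply: spanD => //; exact/spanZ/AB.
Qed.

Lemma span_mono A B x : A `<=` B -> lspan A x -> lspan B x.
Proof. by move=> AB; apply: span_trans => y /AB; exact: span_sub. Qed.

Lemma spanU1P A y x : lspan (y |` A) x -> exists k z, lspan A z /\ x = k *: y + z.
Proof.
elim=> [|k a _ [->|Aa] _ [l [z [Az ->]]]].
- by exists 0, 0; rewrite scale0r addr0; split=> //; exact: span0.
- by exists (k + l), z; rewrite scalerDl addrA.
- exists l, (k *: a + z); split; first exact: spanZD.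
  by rewrite addrCA.
Qed.

Lemma span_coef A k x y : k != 0 -> lspan A x -> lspan A (k *: y + x) -> lspan A y.
Proof.
move=> k0 Ax /spanB-/(_ _ Ax); rewrite addrK => /(spanZ k^-1).
by rewrite scalerA mulVf// scale1r.
Qed.

Lemma span_exchange A x y : lspan (y |` A) x -> ~ lspan A x -> lspan (x |` A) y.
Proof.
move=> /spanU1P[k [z [Az xE]]] nAx.
have k0 : k != 0.
  by apply/eqP => k0; apply: nAx; rewrite xE k0 scale0r add0r.
apply: (@span_coef _ k (z - x)) => //.
  by apply: spanB; [apply: span_mono Az => ? ?; right|apply: span_sub; left].
by rewrite addrA -xE subrr; exact: span0.
Qed.

(** A combination uses finitely many of the nested sets [N g], and the largest of them contains the
    rest; the first alternative occurs if it uses none. *)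
Lemma span_chain (I : Type) (G : set I) (M : set X) (N : I -> set X) x :
  (forall g h, G g -> G h -> N g `<=` N h \/ N h `<=` N g) ->
  lspan (M `|` \bigcup_(g in G) N g) x ->
  lspan M x \/ exists2 g, G g & lspan (M `|` N g) x.
Proof.
move=> ch; elim=> [|k a z Aa _ IH]; first by left; exact: span0.
case: Aa => [Ma|[g Gg Na]].
  case: IH => [Mz|[g Gg gz]]; first by left; exact: spanZD.
  by right; exists g => //; apply: spanZD => //; left.
right; case: IH => [Mz|[h Gh hz]].
  by exists g => //; apply: spanZD; [right|apply: span_mono Mz => ? ?; left].
have [gh|hg] := ch _ _ Gg Gh.
  by exists h => //; apply: spanZD => //; right; exact: gh.
exists g => //; apply: spanZD; first by right.
by apply: span_mono hz => t [?|/hg ?]; [left|right].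
Qed.

Lemma span_list A x : lspan A x -> exists (s : seq X) (c : X -> K),
  [/\ uniq s, (forall y, y \in s -> A y) & x = \sum_(y <- s) c y *: y].
Proof.
elim=> [|k a z Aa _ [s [c [us sA ->]]]].
  by exists [::], (fun=> 0); rewrite big_nil.
have [as_|nas] := boolP (a \in s).
  exists s, (fun y => c y + (if y == a then k else 0)); split=> //.
  under [RHS]eq_bigr do rewrite scalerDl.
  rewrite big_split/= addrC; congr +%R.
  rewrite (bigD1_seq a)//= eqxx big1 ?addr0// => i /negPf ->.
  by rewrite scale0r.
exists (a :: s), (fun y => if y == a then k else c y); split.
- by rewrite /= nas.
- by move=> y; rewrite inE => /orP[/eqP->|/sA].
- rewrite big_cons eqxx; congr +%R; apply: eq_big_seq => y ys.
  by have [ya|//] := eqVneq y a; rewrite -ya ys in nas.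
Qed.

Lemma span_sum A (I : Type) (r : seq I) (P : pred I) (F : I -> X) :
  (forall i, P i -> lspan A (F i)) -> lspan A (\sum_(i <- r | P i) F i).
Proof.
move=> h; apply: (big_ind (lspan A)) => //; first exact: span0.
by move=> ? ?; exact: spanD.
Qed.

(** * Independence, exchange and greedy choice *)

Definition indep A := forall a, A a -> ~ lspan (A `\ a) a.

(* Steinitz' exchange, run along a well-order of [H]: each [h] is traded for some
   [f h] in [Y] outside the lspan of the earlier images and the later [h']. *)
Lemma steinitz (H Y : set X) : indep H -> (forall x, lspan Y x) -> H #<= Y.
Proof.
move=> indH spY; have [lt lto] := strict_well_order_exists X.
suff [f [fY fi]] : exists f : X -> X,
    (forall h, H h -> Y (f h)) /\ {in H &, injective f}.
  rewrite -(card_le_eql (inj_card_eq fi)); apply: subset_card_le => _ [h Hh <-].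
  exact: fY.
have irr x := @swo_irr _ _ x lto.
pose pl h := H `&` [set g | lt g h].
pose pg h := H `&` [set g | lt h g].
pose ge h := H `&` [set g | g = h \/ lt h g].
pose F h (Z : set X) := xget 0 [set y | Y y /\ ~ lspan (Z `|` pg h) y].
have [f fE] := wf_rec F (swo_wf_in H lto).
have fP h : H h -> ~ lspan (f @` pl h `|` pg h) h ->
    Y (f h) /\ ~ lspan (f @` pl h `|` pg h) (f h).
  move=> Hh nh; rewrite fE.
  apply: (@xgetPex _ 0 [set y | Y y /\ ~ lspan (f @` pl h `|` pg h) y]).
  apply: contrapT => /forallNP ny.
  apply: nh; apply: span_trans (spY h) => y Yy; apply: contrapT => nsp.
  by apply: (ny y).
have pg_ge h : pg h `<=` ge h `\ h.
  move=> g [Hg hg]; split; first by split=> //; right.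
  by move=> gh; apply: (irr h); rewrite -{2}gh.
(* Invariant: after the elements before [h] are traded for their images, each remaining [k] is
   outside the span of all the others. *)
have P h : H h -> forall k, ge h k -> ~ lspan (f @` pl h `|` (ge h `\ k)) k.
  elim/(well_founded_ind (swo_wf lto)): h => h IH Hh k [Hk hk].
  pose N g := f @` (H `&` [set g' | g' = g \/ lt g' g]).
  have -> : f @` pl h = \bigcup_(g in pl h) N g.
    apply/seteqP; split=> [_ [g [Hg gh] <-]|_ [g [Hg gh] [g' [Hg' g'g] <-]]].
      by exists g => //; exists g => //; split=> //; left.
    exists g' => //; split=> //=; case: g'g => [->//|g'g].
    exact: swo_trans lto _ _ _ g'g gh.
  (* The images up to [g] grow with [g], so a dependence of [k] contradicts the independence of [H]
     or uses only images up to one [g] before [h]. *)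
  rewrite setUC => /span_chain[|/span_mono kH|[g [Hg gh] /span_mono gk]].
  - move=> g g' _ _; have [gg'|->|g'g] := swo_total lto g g'; [left|by left|right].
      move=> _ [x [Hx xg] <-]; exists x => //; split=> //; right.
      by case: xg => [->//|xg]; exact: swo_trans lto _ _ _ xg gg'.
    move=> _ [x [Hx xg] <-]; exists x => //; split=> //; right.
    by case: xg => [->//|xg]; exact: swo_trans lto _ _ _ xg g'g.
  - by apply: (indH k Hk); apply: kH => g [[Hg _] gk].
  have gk' : lt g k by case: hk => [->//|]; exact: swo_trans lto _ _ _ gh.
  have [_ ng] := fP g Hg (fun gs => IH g gh Hg g (conj Hg (or_introl erefl))
    (span_mono (setUS (pg_ge g)) gs)).
  (* By exchange, [f g] would lie in the span of the earlier images, [k] and the other elements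
     after [g], against its choice. *)
  apply: ng; apply: (@span_mono (k |` (f @` pl g `|` (pg g `\ k)))).
    by move=> x [->|[?|[? ?]]]; [right; split|left|right].
  apply: span_exchange.
    apply: gk => x [[[Hx hx] xk]|[x' [Hx' [->|x'g]] <-]].
    + right; right; split=> //; split=> //=.
      by case: hx => [->//|]; exact: swo_trans lto _ _ _ gh.
    + by left.
    + by right; left; exists x'.
  move=> /span_mono s; apply: (IH g gh Hg k (conj Hk (or_intror gk'))).
  apply: s => x [?|[/pg_ge[? _] xk]]; [by left|by right].
have {}fP h : H h -> Y (f h) /\ ~ lspan (f @` pl h `|` pg h) (f h).
  move=> Hh; apply: fP => // gs; apply: (P h Hh h); first by split=> //; left.
  exact: span_mono (setUS (pg_ge h)) gs.
exists f; split=> [h /fP[]//|h h'].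
rewrite !inE => Hh Hh' fh; have [hh'|//|h'h] := swo_total lto h h'; exfalso.
  by apply: (fP h' Hh').2; apply: span_sub; left; exists h.
by apply: (fP h Hh).2; apply: span_sub; left; exists h'.
Qed.

(* Since [0] is in no [phi b], the value [f b = 0] encodes that no choice was
   possible at [b]. *)
Lemma greedy_choice (T : Type) (lt : T -> T -> Prop) (D : set T) (phi : T -> set X) :
  strict_well_order lt -> (forall b, ~ phi b 0) ->
  exists f : T -> X, indep (f @` D `\ 0) /\
    forall b, D b -> (f b = 0 \/ phi b (f b)) /\
      ((exists x, phi b x /\ ~ lspan (f @` (D `&` [set g | lt g b])) x) ->
       phi b (f b)).
Proof.
move=> lto phi0.
pose F b (Z : set X) := xget 0 [set y | phi b y /\ ~ lspan Z y].
have [f fE] := wf_rec F (swo_wf_in D lto).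
pose below b := f @` (D `&` [set g | lt g b]).
have fP b : f b = 0 \/ phi b (f b) /\ ~ lspan (below b) (f b).
  have [y yE] : exists y, y = F b (below b) by exists (F b (below b)).
  move: (fE b); rewrite -/(below b) -yE => ->; move: yE.
  by rewrite /F; case: xgetP => [z -> [? ?] ->|_ ->]; [right|left].
exists f; split; last first.
  move=> b Db; split; first by case: (fP b) => [|[]]; [left|right].
  by move=> /(@xgetPex _ 0 [set y | phi b y /\ ~ lspan (below b) y])[]; rewrite fE.
move=> _ [[b Db <-] fb0] sp.
pose N h := f @` (D `&` [set g | g = h \/ lt g h]) `\ f b.
have chain (G : set T) g h : G g -> G h -> N g `<=` N h \/ N h `<=` N g.
  move=> _ _; have [gh|->|hg] := swo_total lto g h; [left|by left|right].
    move=> _ [[x [Dx xg] <-] xb]; split=> //; exists x => //; split=> //; right.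
    by case: xg => [->//|xg]; exact: swo_trans lto _ _ _ xg gh.
  move=> _ [[x [Dx xh] <-] xb]; split=> //; exists x => //; split=> //; right.
  by case: xh => [->//|xh]; exact: swo_trans lto _ _ _ xh hg.
have n0 : ~ lspan set0 (f b).
  move=> s0; apply: fb0; elim: s0 => //.
have reach (G : set T) (Z : set X) : Z `<=` \bigcup_(g in G) N g -> lspan Z (f b) ->
    exists2 g, G g & lspan (N g) (f b).
  move=> ZG /(span_mono ZG); rewrite -[\bigcup_(_ in _) _]set0U.
  by move=> /(span_chain (@chain G))[|[g Gg]]; [|rewrite set0U; exists g].
(* For the least [h] such that [f b] depends on the other choices up to [h], the vectors [f b] and
   [f h] can be exchanged; so the later of the two was chosen inside the span of earlier choices. *)
have [h [Dh hs] hmin] : exists2 h, D h /\ lspan (N h) (f b) &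
    forall g, D g /\ lspan (N g) (f b) -> ~ lt g h.
  apply: wf_min (swo_wf lto) _.
  have [|g Dg gs] := reach D _ _ sp; last by exists g.
  move=> _ [[[g Dg <-] g0] gb]; exists g => //.
  by split=> //; exists g => //; split=> //; left.
pose M := below h `\ f b.
have nM : ~ lspan M (f b).
  move=> /(reach (D `&` [set g | lt g h]))[|g [Dg gh] gs]; last exact: (hmin g).
  move=> _ [[g [Dg gh] <-] gb]; exists g => //.
  by split=> //; exists g => //; split=> //; left.
have NM : N h `<=` f h |` M.
  by move=> _ [[g [Dg [->|gh]] <-] gb]; [left|right; split=> //; exists g].
have bh : f b <> f h.
  move=> bh; apply: nM; apply: span_mono hs => x Nx; have [xh|//] := NM x Nx.
  by case: Nx => _ []; rewrite /= xh bh.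
have fhM : ~ lspan M (f h).
  move=> Mh; apply: nM; apply: span_trans (span_mono NM hs) => x [->//|].
  exact: span_sub.
have hb : lspan (f b |` M) (f h) := span_exchange (span_mono NM hs) nM.
have [fh0|[_ nh]] := fP h; first by apply: fhM; rewrite fh0; exact: span0.
have [ltbh|eqbh|lthb] := swo_total lto b h; last 2 first.
- by apply: bh; rewrite eqbh.
- have [//|[_ nb]] := fP b; apply: nb; apply: span_mono hs => _ [[g [Dg gh] <-] _].
  exists g => //; split=> //=; case: gh => [->//|gh].
  exact: swo_trans lto _ _ _ gh lthb.
apply: nh; apply: span_mono hb => x [->|[]//].
by exists b.
Qed.

End Span.

(** * Spans and Hamel bases *)

Section Hamel.
Variables (K : numFieldType) (X : normedModType K).
Implicit Types B : set X.

Lemma indep_of_lin_indep B : lin_indep B -> indep B.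
Proof.
move=> li a Ba /span_list[s [c [us sB aE]]].
have nas : a \notin s by apply/negP => /sB[_ []].
(* Moving [a] to the other side gives a relation with coefficient [-1] at [a]. *)
pose c' y := if y == a then -1 else c y.
have us' : uniq (a :: s) by rewrite /= nas.
have sB' x : x \in a :: s -> B x by rewrite inE => /orP[/eqP->|/sB[]].
have s0 : \sum_(i < size (a :: s)) c' (nth 0 (a :: s) i) *: nth 0 (a :: s) i = 0.
  rewrite -(big_mkord xpredT (fun i => c' (nth 0 (a :: s) i) *: nth 0 (a :: s) i)).
  rewrite -(big_nth 0 xpredT (fun y => c' y *: y)) big_cons /c' eqxx scaleN1r.
  apply/eqP; rewrite addrC subr_eq0 [X in _ == X]aE; apply/eqP.
  apply: eq_big_seq => y ys.
  by have [ya|//] := eqVneq y a; rewrite -ya ys in nas.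
have /= := li (a :: s) (fun i => c' (nth 0 (a :: s) i)) us' sB' s0 0%N isT.
by rewrite /c' eqxx => /eqP; rewrite oppr_eq0 oner_eq0.
Qed.

Lemma hamel_basis_of_span B : indep B -> (forall x, lspan B x) -> hamel_basis B.
Proof.
move=> iB sB; split=> [s c us sb s0 i ils|x].
  apply: contrapT => /eqP ci0; apply: (iB (nth 0 s i)); first exact/sb/mem_nth.
  move: s0; rewrite (bigD1 (Ordinal ils))//= => s0.
  suff : lspan (B `\ nth 0 s i)
      (\sum_(j < size s | j != Ordinal ils) c j *: nth 0 s j).
    by move=> /(span_coef ci0); apply; rewrite s0; exact: span0.
  apply: span_sum => j ji; apply: spanZ; apply: span_sub; split=> /=.
    exact/sb/mem_nth.
  by move=> /eqP; rewrite nth_uniq// => /eqP e; case/eqP: ji; exact: val_inj.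
have [s [c [_ sb ->]]] := span_list (sB x).
exists s, (fun i => c (nth 0 s i)); split=> //.
by rewrite (big_nth 0) big_mkord.
Qed.

Lemma infinite_dimensional_infinite :
  infinite_dimensional X -> infinite_set [set: X].
Proof.
move=> infd /finite_seqP[s sE]; apply: infd; exists s => x.
exists [:: x], (fun=> 1); rewrite /= big_ord_recl big_ord0 /= scale1r addr0.
by split=> // y _; have : [set: X] y by []; rewrite sE.
Qed.

Lemma small_span (H Y : set X) z1 z2 :
  hamel_basis H -> H #= [set: X] -> infinite_set [set: X] ->
  ~ ([set: X] #<= Y) -> exists w, ~ lspan (z1 |` (z2 |` Y)) w.
Proof.
move=> [/indep_of_lin_indep iH _] HX infX; apply: contra_notP => /forallNP sp.
have := @steinitz _ _ H (z1 |` (z2 |` Y)) iH (fun x => contrapT (sp x)).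
rewrite (card_le_eql HX) => h.
exact: infinite_le_setU1 infX (infinite_le_setU1 infX h).
Qed.

End Hamel.

(** * Segments and the radial projection *)

Section Sphere.
Variables (K : numFieldType) (X : normedModType K).
Implicit Types (A B Y Z : set X) (x y z p w : X).

(** Over the complex numbers [0 <= t <= 1] forces [t] to be real, so this is the usual segment for
    both fields. *)
Definition seg z w : set X := (fun t : K => z + t *: (w - z)) @` [set t | 0 <= t <= 1].

Definition normalize x : X := `|x|^-1 *: x.

Lemma norm_normalize x : x != 0 -> `|normalize x| = 1.
Proof.
by move=> x0; rewrite /normalize normrZ normfV normr_id mulVf// normr_eq0.
Qed.

Lemma normalize_id x : `|x| = 1 -> normalize x = x.
Proof. by rewrite /normalize => ->; rewrite invr1 scale1r. Qed.

Lemma norm1_neq0 x : `|x| = 1 -> x != 0.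
Proof. by move=> x1; rewrite -normr_eq0 x1 oner_eq0. Qed.

Lemma normalizeZ (k : K) x : 0 < k -> normalize (k *: x) = normalize x.
Proof.
move=> k0; rewrite /normalize normrZ gtr0_norm// scalerA invfM mulrAC mulVf ?mul1r//.
by rewrite gt_eqF.
Qed.

Lemma span_normalize A x : x != 0 -> lspan A (normalize x) -> lspan A x.
Proof.
move=> x0 /(spanZ `|x|); rewrite /normalize scalerA mulfV ?scale1r//.
by rewrite normr_eq0.
Qed.

(** Projecting moves [x] by the distance from its norm to [1], the norm of [p], hence by at most the
    distance from [x] to [p]. *)
Lemma normalize_dist p x : `|p| = 1 -> x != 0 -> `|normalize x - p| <= `|x - p| *+ 2.
Proof.
move=> p1 x0; rewrite -[X in X - p](subrK x) -addrA mulr2n.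
apply: le_trans (ler_normD _ _) _; apply: lerD => //.
have -> : normalize x - x = (`|x|^-1 - 1) *: x by rewrite scalerBl scale1r.
rewrite normrZ -[X in _ * X]normr_id -normrM.
rewrite mulrBl mulVf ?normr_eq0// mul1r -p1 distrC; exact: ler_dist_dist.
Qed.

Lemma normalize_continuous x : x != 0 -> {for x, continuous normalize}.
Proof.
move=> x0; apply: cvgZ; last exact: cvg_id.
apply: cvgV; first by rewrite normr_eq0.
exact: norm_continuous.
Qed.

Lemma seg_notin_span A z w (t : K) : lspan A z -> ~ lspan A w -> t != 0 ->
  ~ lspan A (z + t *: (w - z)).
Proof.
move=> Az Aw t0 /spanB-/(_ _ Az); rewrite addrAC subrr add0r.
move=> /(spanZ t^-1); rewrite scalerA mulVf// scale1r => /spanD-/(_ _ Az).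
by rewrite subrK.
Qed.

Lemma near_notin_span A z w (e : K) : 0 < e -> lspan A z -> ~ lspan A w ->
  exists2 v, ~ lspan A v & `|v - z| < e.
Proof.
move=> e0 Az Aw.
have w0 : 0 < `|w|.
  by rewrite normr_gt0; apply/eqP => w0; apply: Aw; rewrite w0; exact: span0.
have k0 : 0 < e / 2 / `|w| by rewrite !divr_gt0.
exists (z + (e / 2 / `|w|) *: w); last first.
  rewrite addrAC subrr add0r normrZ gtr0_norm// divfK ?gt_eqF//.
  by rewrite ltr_pdivrMr// mulr_natr mulr2n ltrDl.
move=> /spanB-/(_ _ Az); rewrite addrAC subrr add0r => /(spanZ (e / 2 / `|w|)^-1).
by rewrite scalerA mulVf ?gt_eqF// scale1r.
Qed.

Lemma ball_seg x (r : K) z w : ball x r z -> ball x r w -> seg z w `<=` ball x r.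
Proof.
rewrite -!ball_normE/= => xz xw _ [t /andP[t0 t1] <-] /=.
have -> : x - (z + t *: (w - z)) = (1 - t) *: (x - z) + t *: (x - w).
  rewrite scalerBl scale1r -addrA [- _ + _]addrC -scalerBr opprD addrA -scalerN.
  by congr (_ + _ *: _); rewrite !opprB [RHS]addrC addrA subrK.
apply: le_lt_trans (ler_normD _ _) _; rewrite !normrZ !ger0_norm ?subr_ge0//.
have -> : r = (1 - t) * r + t * r by rewrite -mulrDl subrK mul1r.
have [->|tn0] := eqVneq t 0; first by rewrite !mul0r !addr0 subr0 !mul1r.
apply: ler_ltD; first by rewrite ler_wpM2l ?subr_ge0// ltW.
by rewrite ltr_pM2l// lt_neqAle eq_sym tn0.
Qed.

(** * Sets meeting all large closed sets *)

Section Meeting.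
Variable B : set X.
(* [~ ([set: X] #<= Y)] says that Y has smaller cardinality than X. *)
Hypothesis seg_connected : forall z w, connected (seg z w).
Hypothesis B1 : forall b, B b -> `|b| = 1.
Hypothesis small_span : forall Y z1 z2, ~ ([set: X] #<= Y) ->
  exists w, ~ lspan (z1 |` (z2 |` Y)) w.
Hypothesis BF : forall F, closed F ->
  (forall Y, ~ ([set: X] #<= Y) -> exists x, [/\ F x, `|x| = 1 & ~ lspan Y x]) ->
  exists2 b, B b & F b.

(** Small balls around the direction of [z] contain unit vectors outside any small span, so [B]
    meets their closures. *)
Lemma normalize_dense z (O : set X) : z != 0 -> nbhs z O ->
  exists q, [/\ O q, q != 0 & B (normalize q)].
Proof.
move=> z0 /nbhs_ballP[e /= e0 eO]; set p := normalize z.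
have zp : 0 < `|z| by rewrite normr_gt0.
have p1 : `|p| = 1 by exact: norm_normalize.
(* A point in the closure of the ball is within [2 * d] of [p]; scaling by the norm of [z] makes
   this [e]. *)
pose d := e / `|z| / 2.
have d0 : 0 < d by rewrite !divr_gt0.
have [||b Bb bF] := BF (F := closure (ball p d)); first exact: closed_closure.
  move=> Y /(small_span p p)[w wY].
  have pY : lspan (p |` (p |` Y)) p by apply: span_sub; left.
  have [v vY vp] := near_notin_span (divr_gt0 d0 (ltr0Sn _ 1)) pY wY.
  have v0 : v != 0 by apply/eqP => v0; apply: vY; rewrite v0; exact: span0.
  exists (normalize v); split; last 2 first.
  - exact: norm_normalize.
  - move=> /(span_normalize v0) Yv; apply: vY; apply: span_mono Yv => y Yy.
    by right; right.
  apply: subset_closure; rewrite -ball_normE/= distrC.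
  apply: le_lt_trans (normalize_dist p1 v0) _.
  by rewrite -mulr_natr -ltr_pdivlMr.
have [y []] := bF _ (nbhsx_ballx b d d0).
rewrite -!ball_normE/= distrC [`|b - y|]distrC => py yb.
have b1 := B1 Bb.
exists (`|z| *: b); split.
- apply: eO; rewrite -ball_normE/=.
  have zE : z = `|z| *: p by rewrite scalerA mulfV ?gt_eqF// scale1r.
  rewrite [X in X - _]zE -scalerBr normrZ normr_id mulrC -ltr_pdivlMr//.
  rewrite -(subrK y p) -addrA; apply: le_lt_trans (ler_normD _ _) _.
  have -> : e / `|z| = d + d by rewrite -mulr2n -mulr_natr divfK.
  by rewrite ltrD// distrC.
- by rewrite scaler_eq0 negb_or normr_eq0 z0 norm1_neq0.
- by rewrite normalizeZ// normalize_id.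
Qed.

(** The corner [w] is left to [link]: any vector outside the span serves in the punctured space,
    while in a ball one close to [z1] is taken. *)
Lemma cone_connected Z : open Z -> ~ Z 0 ->
  (forall A z1 z2, Z z1 -> Z z2 -> lspan A z1 -> lspan A z2 ->
    (exists w, ~ lspan A w) ->
    exists w, [/\ ~ lspan A w, seg z1 w `<=` Z & seg z2 w `<=` Z]) ->
  connected (B `&` closure (normalize @` Z)).
Proof.
move=> oZ Z0 link E [u Eu] [U oU EU] [G cG EG].
have Zn0 z : Z z -> z != 0 by move=> Zz; apply/eqP => z0; apply: Z0; rewrite -z0.
have nZ A : A `<=` Z -> {within A, continuous normalize}.
  move=> AZ; apply: continuous_in_subspaceT => x /set_mem/AZ/Zn0.
  exact: normalize_continuous.
apply/seteqP; split; first by move=> x; rewrite EU => -[].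
move=> v Nv; apply: contrapT => nEv.
have oV := closed_openC cG.
have GV : ~ G v by move=> Gv; apply: nEv; rewrite EG.
(* A priori [U] and the complement of [G] are disjoint only on part of [B]; the density of
   directions from [B] extends this to the projection of [Z]. *)
have UVZ q : Z q -> U (normalize q) -> G (normalize q).
  move=> Zq Uq; apply: contrapT => Gq.
  have [|q' [[Zq' [Uq' Gq']] q'0 Bq']] :=
    @normalize_dense q (Z `&` (normalize @^-1` (U `&` ~` G))) (Zn0 _ Zq).
    apply: filterI; first exact: open_nbhs_nbhs.
    apply: normalize_continuous; first exact: Zn0.
    by apply: open_nbhs_nbhs; split; [exact: openI|].
  have : E (normalize q').
    by rewrite EU; split=> //; split=> //; apply: subset_closure; exists q'.
  by rewrite EG => -[].
have [Nu Uu] : (B `&` closure (normalize @` Z)) u /\ U u by move: Eu; rewrite EU => -[].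
have [_ [[z1 Zz1 <-] Uz1]] := Nu.2 U (open_nbhs_nbhs (conj oU Uu)).
have [_ [[z2 Zz2 <-] Gz2]] := Nv.2 (~` G) (open_nbhs_nbhs (conj oV GV)).
have [||b Bb [bW bUV]] := BF (F := closure (normalize @` Z) `&` ~` (U `|` ~` G)).
- apply: closedI; first exact: closed_closure.
  by apply: open_closedC; exact: openU.
- move=> Y /(small_span z1 z2) Yw; set A := z1 |` (z2 |` Y) in Yw.
  have Az1 : lspan A z1 by apply: span_sub; left.
  have Az2 : lspan A z2 by apply: span_sub; right; left.
  have [w [Aw s1 s2]] := link _ _ _ Zz1 Zz2 Az1 Az2 Yw.
  pose P := normalize @` seg z1 w `|` normalize @` seg z2 w.
  have cP : connected P.
    apply: connectedU; last 2 first.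
    - by apply: connected_continuous_connected; [exact: seg_connected|exact: nZ].
    - by apply: connected_continuous_connected; [exact: seg_connected|exact: nZ].
    exists (normalize w); split; exists w => //; exists 1;
      by rewrite /= ?ler01 ?lexx// scale1r subrKC.
  have z1P : P (normalize z1).
    by left; exists z1 => //; exists 0; rewrite /= ?ler01 ?lexx// scale0r addr0.
  have z2P : P (normalize z2).
    by right; exists z2 => //; exists 0; rewrite /= ?ler01 ?lexx// scale0r addr0.
  have PZ : P `<=` normalize @` Z by move=> _ [[q /s1 ? <-]|[q /s2 ? <-]]; exists q.
  (* Otherwise [U] cuts out a clopen part of [P], so by connectedness it contains the projection of
     [z2]. *)
  have [a Pa aUV] : exists2 a, P a & ~ (U `|` ~` G) a.
    apply: contrapT => h.
    have PUG : P `<=` U `|` ~` G.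
      by move=> a Pa; apply: contrapT => aUV; apply: h; exists a.
    have : P `&` U = P.
      apply: cP; first by exists (normalize z1).
        by exists U.
      exists G => //; apply/seteqP; split=> q [Pq] qq; split=> //.
        by have [q' Zq' q'q] := PZ _ Pq; rewrite -q'q; apply: UVZ; rewrite ?q'q.
      by have [//|/(_ qq)] := PUG _ Pq.
    by move/seteqP => [_ /(_ _ z2P)[_ Uz2]]; apply: Gz2; exact: UVZ.
  exists a; split.
  - by split=> //; apply: subset_closure; exact: PZ.
  - by have [q Zq <-] := PZ _ Pa; apply: norm_normalize; exact: Zn0.
  (* The projections of [z1] and [z2] lie in the two open sets, so [t] is nonzero and the segment
     has left the span of [A]. *)
  - case: Pa => -[q /[dup] qs [t t01 qE] qa] Ya.
      have q0 := Zn0 _ (s1 _ qs); have t0 : t != 0.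
        by apply/eqP => t0; apply: aUV; left; rewrite -qa -qE t0 scale0r addr0.
      apply: (seg_notin_span Az1 Aw t0); rewrite qE; apply: (span_normalize q0).
      by rewrite qa; apply: span_mono Ya => y; right; right.
    have q0 := Zn0 _ (s2 _ qs); have t0 : t != 0.
      by apply/eqP => t0; apply: aUV; right; rewrite -qa -qE t0 scale0r addr0.
    apply: (seg_notin_span Az2 Aw t0); rewrite qE; apply: (span_normalize q0).
    by rewrite qa; apply: span_mono Ya => y; right; right.
(* A point of [B] and the closure that is in [G] belongs to [E], hence to [U], so [b] cannot avoid
   both open sets. *)
apply: bUV; have [Gb|] := pselect (G b); last by right.
have : E b by rewrite EG.
by rewrite EU => -[_ Ub]; left.
Qed.

Lemma meeting_connected : connected B.
Proof.
have -> : B = B `&` closure (normalize @` ~` [set 0]).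
  apply/seteqP; split=> [b Bb|b []//]; split=> //.
  apply: subset_closure; exists b; last exact/normalize_id/B1.
  by apply/eqP; exact/norm1_neq0/B1.
apply: cone_connected; [|by move=> /(_ erefl)|].
  by apply: closed_openC; apply: accessible_closed_set1;
    exact/hausdorff_accessible/norm_hausdorff.
move=> A z1 z2 z10 z20 Az1 Az2 [w Aw]; exists w.
(* Beyond [z] the segment stays outside the span of [A], which contains [0]. *)
have key z : lspan A z -> z <> 0 -> seg z w `<=` ~` [set 0].
  move=> Az z0 _ [t _ <-] /=; have [->|t0] := eqVneq t 0.
    by rewrite scale0r addr0.
  by move=> e; apply: (seg_notin_span Az Aw t0); rewrite e; exact: span0.
by split=> //; exact: key.
Qed.

Lemma meeting_locally_connected : locally_connected_set B.
Proof.
move=> x Bx O /nbhs_ballP[e /= e0 eO]; have x1 := B1 Bx.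
(* Chosen so that [r < 1], which keeps the ball away from [0], and [3 * r < e]. *)
pose r := (1 + 3 / e)^-1.
have c0 : 0 < 1 + 3 / e by rewrite addr_gt0// divr_gt0.
have r0 : 0 < r by rewrite invr_gt0.
have r1 : r < 1.
  by rewrite invf_lt1// ltrDl divr_gt0.
have re : r *+ 3 < e.
  rewrite -mulr_natr mulrC ltr_pdivrMr// mulrDr mulr1 mulrC divfK ?gt_eqF//.
  by rewrite ltrDr.
exists (B `&` closure (normalize @` ball x r)).
have Z0 z : ball x r z -> z != 0.
  rewrite -ball_normE/= => xz; apply/eqP => z0; move: xz.
  by rewrite z0 subr0 x1 => /lt_trans-/(_ _ r1); rewrite ltxx.
split.
- move=> b [Bb bW]; split=> //; apply: eO.
  (* One [r] is spent on the closure and [2 * r] on the projection. *)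
  have [_ [[z xz <-]]] := bW _ (nbhsx_ballx b r r0); have z0 := Z0 _ xz.
  move: xz; rewrite -!ball_normE/= => xz bz; apply: le_lt_trans re.
  rewrite -(subrK (normalize z) x) -addrA mulrS addrC.
  apply: le_trans (ler_normD _ _) _; apply: lerD.
    by rewrite distrC ltW.
  rewrite distrC; apply: le_trans (normalize_dist x1 z0) _.
  by rewrite lerMn2r distrC ltW ?orbT.
- apply: cone_connected; [exact: ball_open| |].
    by move=> /Z0; rewrite eqxx.
  move=> A z1 z2 z1x z2x Az1 Az2 [w Aw].
  have := open_nbhs_nbhs (conj (ball_open x r) z1x).
  move=> /nbhs_ballP[d /= d0 dZ].
  have [v Av vz1] := near_notin_span d0 Az1 Aw.
  have xv : ball x r v by apply: dZ; rewrite -ball_normE/= distrC.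
  by exists v; split=> //; exact: ball_seg.
- exists (ball x r); split; first exact: nbhsx_ballx.
  move=> b [Bb xb]; split=> //; apply: subset_closure; exists b => //.
  exact/normalize_id/B1.
Qed.

End Meeting.
End Sphere.

(** * The basis by transfinite choice *)

(** Connectedness of segments is the only point where the two fields are treated separately. *)
Lemma conclusion_of_seg_connected (K : numFieldType) (X : normedModType K) :
  (forall z w : X, connected (seg z w)) -> hypotheses X -> conclusion X.
Proof.
move=> segc [infd [OX [H [hH HX]]]].
have infX := infinite_dimensional_infinite infd.
have [lt [D [lto XD Dsmall]]] := initial_well_order X.
have OD : @open_sets K X #<= D by rewrite (card_le_eql OX).
(* Complements of the enumerated open sets exhaust the closed sets. *)
have [g gsurj] : exists g : X -> set X,
    forall F, closed F -> exists2 b, D b & g b = ~` F.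
  case/pfcard_geP: OD => [op0|[g]].
    by have : @open_sets K X setT; [exact: openT|rewrite op0].
  exists g => F cF; have [b Db gb] := @surj _ _ _ _ g (~` F) (closed_openC cF).
  by exists b.
pose phi b := [set x : X | ~ g b x /\ `|x| = 1].
have [b [_]|f [iB fP]] := @greedy_choice _ _ _ lt D phi lto.
  by rewrite normr0 => /esym/eqP; rewrite oner_eq0.
(* Stages without a choice have value [0], which is removed. *)
set B := f @` D `\ 0 in iB.
have B1 b : B b -> `|b| = 1.
  by move=> [[c Dc <-] c0]; have [[//|[]]] := fP c Dc.
have spB A x : A `<=` f @` D -> lspan A x -> lspan B x.
  move=> AD; apply: span_trans => y /AD Dy; have [->|/eqP y0] := eqVneq y 0.
    exact: span0.
  exact: span_sub.
have below_sub b : f @` (D `&` [set c | lt c b]) `<=` f @` D.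
  by move=> _ [c [Dc _] <-]; exists c.
have sB x : lspan B x.
  have [->|x0] := eqVneq x 0; first exact: span0.
  apply: (span_normalize x0).
  (* At the stage of this singleton its point is spanned already or is the only candidate. *)
  have [|b Db gb] := gsurj [set normalize x].
    by apply: accessible_closed_set1; exact/hausdorff_accessible/norm_hausdorff.
  have [lx|nlx] := pselect (lspan (f @` (D `&` [set c | lt c b])) (normalize x)).
    exact: spB lx.
  have [_ /(_ _)[|]] := fP b Db.
    exists (normalize x); split=> //.
    by split; [rewrite gb /=; apply|exact: norm_normalize].
  rewrite gb => /contrapT /= <- _; apply: (spB (f @` D)) => //.
  by apply: span_sub; exists b.
have BF (F : set X) : closed F ->
    (forall Y, ~ ([set: X] #<= Y) -> exists x : X, [/\ F x, `|x| = 1 & ~ lspan Y x]) ->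
    exists2 b, B b & F b.
  move=> /gsurj[b Db gb] /(_ (f @` (D `&` [set c | lt c b])))[|x [Fx x1 nx]].
    (* The earlier choices come from a proper initial segment of [D], so they are too few. *)
    by move=> /card_le_trans-/(_ _ _ (card_image_le _ _)); exact: Dsmall.
  have [_ /(_ _)[|]] := fP b Db.
    by exists x; split=> //; split=> //; rewrite gb; apply.
  rewrite gb => /contrapT Ff f1; exists (f b) => //; split; first by exists b.
  by move=> /= f0; move: (norm1_neq0 f1); rewrite f0 eqxx.
have small (Y : set X) (z1 z2 : X) :
    ~ ([set: X] #<= Y) -> exists w, ~ lspan (z1 |` (z2 |` Y)) w.
  exact: small_span hH HX infX.
exists B; split=> //.
- exact: hamel_basis_of_span.
- exact: meeting_connected.
- exact: meeting_locally_connected.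
Qed.

(** * Connected segments over both fields *)

Lemma real_seg_connected (R : realType) (X : normedModType R) (z w : X) :
  connected (seg z w).
Proof.
apply: connected_continuous_connected; last first.
  apply: continuous_subspaceT => t; apply: cvgD; first exact: cvg_cst.
  by apply: cvgZ; [exact: cvg_id|exact: cvg_cst].
have -> : [set t : R | 0 <= t <= 1] = [set` `[0, 1]].
  by apply/seteqP; split=> t /=; rewrite in_itv.
exact: segment_connected.
Qed.

Lemma complex_seg_connected (R : realType) (X : normedModType (complex R)) (z w : X) :
  connected (seg z w).
Proof.
have -> : seg z w = (fun t : R => z + (t%:C)%C *: (w - z)) @` [set` `[0, 1]].
  apply/seteqP; split=> [_ [t /andP[t0 t1] <-]|_ [t /= + <-]].
    have tR : (complex.Re t)%:C%C = t by rewrite RRe_real// ger0_real.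
    exists (complex.Re t); last by rewrite tR.
    by rewrite /= in_itv/= -!lecR tR t0.
  by rewrite in_itv/= => t01; exists (t%:C)%C => //; rewrite /= !lecR.
apply: connected_continuous_connected; first exact: segment_connected.
apply: continuous_subspaceT => t; apply: cvgD; first exact: cvg_cst.
apply: cvgZ; last exact: cvg_cst.
apply/cvgrPdist_lt => e e0.
have eR : (complex.Re e)%:C%C = e by rewrite RRe_real// gtr0_real.
have e0' : 0 < complex.Re e by rewrite -ltcR eR.
near=> s.
(* The norm of an embedded real is its absolute value. *)
rewrite -rmorphB normc_def /= expr0n addr0 sqrtr_sqr -eR ltcR.
near: s.
by apply: cvgr_dist_lt => //; exact: cvg_id.
Unshelve. all: by end_near. Qed.

Theorem theorem1 (R : realType) :
  (forall X : normedModType R, hypotheses X -> conclusion X) /\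
  (forall X : normedModType (complex R), hypotheses X -> conclusion X).
Proof.
split=> X; apply: conclusion_of_seg_connected => z w.
- exact: real_seg_connected.
- exact: complex_seg_connected.
Qed.
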